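(* Let $n\ge 2$ be an integer, let $\mathcal{Q}_{4n}$ be the dicyclic group of order $4n$, and let $k=\phi(2n)$ be the number of generators of the cyclic group $C_{2n}$ of order $2n$, where $\phi$ is Euler's totient function. Then the second largest eigenvalue of the power graph $\mathcal{P}(\mathcal{Q}_{4n})$ satisfies $\lambda_{2}(\mathcal{P}(\mathcal{Q}_{4n}))\ge \mu_{2}$, where $\mu_2$ is the second largest root of the equation $$\mu^{3}-(k+1)\mu^{2}-(4n+1)\mu+(4kn-4n+k+1)=0.$$
   Context: The power graph $\mathcal{P}(\mathbb{G})$ of a finite group $\mathbb{G}$ is the simple undirected graph with vertex set $\mathbb{G}$ in which two distinct elements $x,y$ are adjacent if and only if one of them is an integral power of the other. The dicyclic group is $\mathcal{Q}_{4n}=\langle a,b \mid a^{2n}=e,\ a^n=b^2,\ ab=ba^{-1}\rangle$, of order $4n$. The eigenvalues of a graph $G$ on $N$ vertices are those of its adjacency matrix, listed with multiplicity as $\lambda_1(G)\ge\lambda_2(G)\ge\cdots\ge\lambda_N(G)$; $\lambda_2(G)$ is the second largest eigenvalue. Roots of the cubic are likewise ordered with multiplicity. *)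

(* Defs.v *)
From HB Require Import structures.
From mathcomp Require Import all_boot all_order all_algebra all_fingroup.
From mathcomp Require Import polyrcf.

Set Implicit Arguments.
Unset Strict Implicit.
Unset Printing Implicit Defensive.

Import Order.TTheory GRing.Theory Num.Theory.

Local Open Scope ring_scope.

(* In general _ \isog Grp _ characterizes the largest finite quotient of the
   presented group; for n > 0 the group presented here is itself finite, of
   order 4n, so that G is isomorphic to it. *)
Definition dicyclic (n : nat) (gT : finGroupType) (G : {group gT}) : Prop :=
  (G \isog Grp (a : b : a ^+ (2 * n)%N, a ^+ n = b ^+ 2, a * b = b * a^-1))%g.

(* <[x]> is the set of integral powers of x. *)
Definition power_graph (gT : finGroupType) : rel gT :=
  fun x y => (x != y) && ((x \in <[y]>%g) || (y \in <[x]>%g)).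

(* Adjacency matrix of the graph with vertex set A and edge relation e. The
   numbering of the vertices by enum_val does not affect the spectrum. *)
Definition adjacency_mx (R : rcfType) (T : finType) (A : {set T}) (e : rel T) :
    'M[R]_#|A| :=
  \matrix_(i < #|A|, j < #|A|) (e (enum_val i) (enum_val j))%:R.

(* rootsR p lists each root of p in R once, and mup x p is the multiplicity of
   x as a root of p. *)
Definition desc_roots (R : rcfType) (p : {poly R}) : seq R :=
  sort >=%R (flatten [seq nseq (mup x p) x | x <- rootsR p]).

Lemma desc_roots_sorted (R : rcfType) (p : {poly R}) :
  sorted >=%R (desc_roots p).
Proof. by apply: sort_sorted => x y; apply: ge_total. Qed.

Lemma count_desc_roots (R : rcfType) (p : {poly R}) (x : R) :
  p != 0 -> count_mem x (desc_roots p) = mup x p.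
Proof.
move=> p0; rewrite count_sort count_flatten -map_comp.
have Ur : uniq (rootsR p) by apply/lt_sorted_uniq/sorted_roots.
have rP : (x \in rootsR p) = root p x.
  by rewrite -(roots_on_rootsR p0) inE.
rewrite (eq_map (g := fun y => (y == x) * mup y p)%N); last first.
  by move=> y /=; rewrite count_nseq.
rewrite sumnE big_map; have [xr|xNr] := boolP (x \in rootsR p).
  rewrite (bigD1_seq x) //= eqxx mul1n big1 ?addn0 // => y /negPf->.
  by rewrite mul0n.
rewrite big_seq big1 => [|y yr].
  by rewrite mupNroot // -rP.
by case: eqP yr xNr => [->->|].
Qed.

(* The eigenvalues of a real symmetric matrix are all real, so for such a
   matrix this is the full spectrum, with n entries. *)
Definition eigenvalues (R : rcfType) (n : nat) (M : 'M[R]_n) : seq R :=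
  desc_roots (char_poly M).

(* Main.v *)
Require Import Defs.
From mathcomp Require Import all_boot all_order all_algebra all_fingroup.
From mathcomp Require Import all_solvable polyrcf ring lra.
From mathcomp Require Import spectral sesquilinear complex.

(** The cubic is the characteristic polynomial of a quotient of an induced
    subgraph.  Let [<[x]>] be the cyclic subgroup of order [2 n] of the dicyclic
    group, and [z = x^n].  In the power graph the three cells [{1, z}], the [k]
    generators of [<[x]>], and the [2 n] elements outside [<[x]>] induce a
    subgraph in which the number of neighbours in a cell of a vertex depends
    only on its own cell ([cell_regular]); the matrix of these numbers has the
    rows [(1, k, 2n)], [(2, k - 1, 0)], [(2, 0, 1)], and its characteristic
    polynomial is the cubic.  One thus expects the bound from eigenvalue
    interlacing.

    Both interlacing steps, from the graph to the subgraph and from the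
    subgraph to its quotient, are contained in a single use of the
    Courant-Fischer lower bound ([eigenvalue_ge_of_nonneg_form]): it suffices
    to find a plane of vectors, constant on the cells and zero elsewhere, on
    which the form of [A - c] is nonnegative, where [c] is the second largest
    root ([eigenvalue_ge_of_regular_cells]).  Such a plane is spanned by an
    eigenvector of the quotient matrix for [c] ([quotient_kernel]), which is
    in the radical of the form restricted to vectors of this kind, and by the
    indicator vector of the generators, at which the form takes the value
    [k (k - 1 - c)].  This is nonnegative because the second largest root is
    at most [k - 1] ([quotient_cubic_second_root]).

    The Courant-Fischer bound itself is read off a unitary diagonalization over
    [R[i]].  On the group side, the presentation has to be shown not to
    collapse: permutations realizing its regular representation give the order
    [4 n] ([dicyclic_model], [dicyclic_structure]). *)

Set Implicit Arguments.
Unset Strict Implicit.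
Unset Printing Implicit Defensive.

Import Order.TTheory GRing.Theory Num.Theory.

Local Open Scope ring_scope.

(** * Eigenvalues of real symmetric matrices *)

Lemma desc_roots_prod (R : rcfType) (s : seq R) :
  desc_roots (\prod_(x <- s) ('X - x%:P)) = sort >=%R s.
Proof.
have p0 : \prod_(x <- s) ('X - x%:P) != 0.
  by rewrite monic_neq0 // monic_prod_XsubC.
apply: (sorted_eq ge_trans ge_anti).
- exact: desc_roots_sorted.
- by apply: sort_sorted => x y; apply: ge_total.
apply/allP => x _ /=.
by rewrite count_desc_roots // mu_prod_XsubC count_sort.
Qed.

Section RealSymmetric.

Import Num.Def.
Local Open Scope sesquilinear_scope.
Local Notation toC := (real_complex _).

Lemma map_mx_real_complex_conj (R : rcfType) m n (A : 'M[R]_(m, n)) :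
  (map_mx toC A) ^ conjC = map_mx toC A.
Proof.
apply/matrixP=> i j; rewrite !mxE; apply/CrealP/complex_realP.
by exists (A i j).
Qed.

Lemma char_poly_conjugate (F : fieldType) n (P B : 'M[F]_n) :
  P \in unitmx -> char_poly (invmx P *m B *m P) = char_poly B.
Proof.
move=> uP; rewrite /char_poly /char_poly_mx !map_mxM /=.
set Q := map_mx polyC (invmx P); set P' := map_mx polyC P.
have QP : Q *m P' = 1%:M by rewrite -map_mxM mulVmx // map_mx1.
have -> : 'X%:M - Q *m map_mx polyC B *m P' =
          Q *m ('X%:M - map_mx polyC B) *m P'.
  by rewrite mulmxBr mulmxBl scalar_mxC -(mulmxA 'X%:M) QP mulmx1.
by rewrite !det_mulmx mulrAC -det_mulmx QP det1 mul1r.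
Qed.

(** A real symmetric matrix becomes Hermitian over [R[i]], where the spectral
    theorem gives a unitary diagonalization with real diagonal [d].  As [d] is
    real, the characteristic polynomial already splits over [R], and so the
    real roots that define [eigenvalues A] are exactly the entries of [d]. *)
Lemma real_symmetric_spectral (R : rcfType) n (A : 'M[R]_n) : A^T = A ->
  exists (P : 'M[R[i]]_n) (d : 'I_n -> R),
  [/\ P \is unitarymx,
      map_mx toC A = P^t* *m diag_mx (\row_i (d i)%:C%C) *m P &
      eigenvalues A = sort >=%R [seq d i | i <- enum 'I_n]].
Proof.
move=> symA; pose B : 'M[R[i]]_n := map_mx toC A.
have hB : B \is hermsymmx.
  have tB : B^T = B by rewrite map_trmx symA.
  by apply/is_hermitianmxP; rewrite expr0 scale1r tB map_mx_real_complex_conj.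
have /hermitian_normalmx/orthomx_spectralP := hB.
have /mxOverP dR := hermitian_spectral_diag_real hB.
have := spectral_unitarymx B.
set P := spectralmx B; set D := spectral_diag B => uP defB.
exists P, (fun i => complex.Re (D 0 i)).
have defD : \row_i (complex.Re (D 0 i))%:C%C = D.
  by apply/rowP => i; rewrite mxE RRe_real.
split=> //; first by rewrite defD -invmx_unitary.
rewrite /eigenvalues -desc_roots_prod; congr desc_roots.
rewrite big_map; apply: (map_poly_inj toC).
rewrite map_char_poly -/B rmorph_prod /= defB.
rewrite char_poly_conjugate ?unitarymx_unit //.
rewrite char_poly_trig ?diag_mx_is_trig // big_enum /=.
apply: eq_bigr => i _; rewrite rmorphB /= map_polyX map_polyC /= RRe_real //.
by rewrite !mxE eqxx.
Qed.

Definition nonneg_form (R : numDomainType) n (H : 'M[R]_n) :=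
  forall v : 'rV_n, 0 <= (v *m H *m v^T) 0 0.

(** Writing [w = a + 'i b] with real rows [a] and [b], symmetry of [H] cancels
    the cross terms of the Hermitian form, and what is left is the sum of the
    values of the real form at [a] and at [b]. *)
Lemma nonneg_form_complex (R : rcfType) n (H : 'M[R]_n) (w : 'rV[R[i]]_n) :
  H^T = H -> nonneg_form H -> 0 <= (w *m map_mx toC H *m w^t*) 0 0.
Proof.
move=> symH psdH.
pose a := map_mx (@complex.Re R) w; pose b := map_mx (@complex.Im R) w.
have defw : w = map_mx toC a + 'i *: map_mx toC b.
  by apply/rowP => i; rewrite !mxE complexRe complexIm -Crect.
clearbody a b.
have defwt : w^t* = (map_mx toC a)^T - 'i *: (map_mx toC b)^T.
  rewrite defw linearD linearZ /= map_mxD map_mxZ /= conjCi scaleNr.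
  by rewrite -!map_trmx !map_mx_real_complex_conj.
have cross : a *m H *m b^T = b *m H *m a^T.
  have tr11 (M : 'M[R]_1) : M^T = M by apply/matrixP=> i j; rewrite mxE !ord1.
  by rewrite -[LHS]tr11 !trmx_mul trmxK symH mulmxA.
rewrite defwt {1}defw !(mulmxDl, mulmxBr, mulmxDr) -!scalemxAl -!scalemxAr.
rewrite scalerA -expr2 sqrCi scaleN1r !map_trmx -!map_mxM cross.
rewrite addrKA opprK !mxE -rmorphD ler0c addr_ge0 //.
  by have := psdH a; rewrite mxE.
by have := psdH b; rewrite mxE.
Qed.

Lemma count_sorted_ge (R : realDomainType) (s : seq R) (c : R) p :
  sorted >=%R s -> (p < size s)%N -> s`_p < c -> (count (>= c) s <= p)%N.
Proof.
move=> srt ltps ltc; rewrite -[s in count _ s](cat_take_drop p) count_cat.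
have /eqP-> : count (>= c) (drop p s) == 0%N.
  rewrite -leqn0 leqNgt -has_count -all_predC; apply/(all_nthP 0) => i.
  rewrite size_drop nth_drop /= -ltNge => lti; apply: le_lt_trans ltc.
  apply: (sorted_leq_nth ge_trans lexx) => //; rewrite ?inE ?leq_addr //.
  by rewrite -ltn_subRL.
by rewrite addn0 (leq_trans (count_size _ _)) // size_take ltps.
Qed.

(** The lower bound of Courant and Fischer: if the quadratic form of [A - c] is
    nonnegative on the [p.+1]-dimensional row space of [U], then the eigenvalue
    of rank [p], counting from 0, is at least [c].  Otherwise at most [p]
    eigenvalues would be [>= c], and a dimension count would give a nonzero
    vector of that row space, over [R[i]], orthogonal to all the corresponding
    eigenvectors; the form is negative there. *)
Lemma eigenvalue_ge_of_nonneg_form (R : rcfType) n (A : 'M[R]_n) (c : R) p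
    (U : 'M[R]_(p.+1, n)) :
  A^T = A -> row_free U -> nonneg_form (U *m (A - c%:M) *m U^T) ->
  c <= (eigenvalues A)`_p.
Proof.
move=> symA freeU psdU.
have [P [d [uP defA eigA]]] := real_symmetric_spectral symA.
rewrite leNgt; apply/negP => ltc.
pose I : {set 'I_n} := [set i | c <= d i].
have leIp : (#|I| <= p)%N.
  have -> : #|I| = count (>= c) (eigenvalues A).
    by rewrite eigA count_sort count_map cardsE cardE size_filter enumT.
  apply: count_sorted_ge ltc; first exact: desc_roots_sorted.
  rewrite eigA size_sort size_map size_enum_ord.
  by move: freeU; rewrite /row_free => /eqP <-; apply: rank_leq_col.
(* The rows of [K] are the rows of [U] in the eigenbasis; [KI] keeps only the
   at most [p] coordinates with eigenvalue [>= c], so it has a kernel. *)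
pose K := map_mx toC U *m P^t*.
pose KI := colsub (fun i : 'I_#|I| => enum_val i) K.
have : ~~ row_free KI.
  by rewrite /row_free neq_ltn (leq_ltn_trans (rank_leq_col _)).
rewrite -kermx_eq0 => /rowV0Pn[w /sub_kermxP wK w0].
pose y := w *m K.
have yI i : i \in I -> y 0 i = 0.
  move=> iI; have /rowP/(_ (enum_rank_in iI i)) := wK.
  rewrite mxE [X in _ = X -> _]mxE => h; rewrite -[RHS]h /y mxE.
  apply: eq_bigr => k _.
  by rewrite [in RHS]mxE enum_rankK_in.
have PtP : P^t* *m P = 1%:M.
  by rewrite -invmx_unitary // mulVmx // unitarymx_unit.
have y0 : y != 0.
  have tP : row_free (P^t*).
    by rewrite row_free_unit -invmx_unitary // unitmx_inv unitarymx_unit.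
  by rewrite mulmx_free_eq0 // /row_free mxrankMfree // mxrank_map.
have symC : (U *m (A - c%:M) *m U^T)^T = U *m (A - c%:M) *m U^T.
  by rewrite !trmx_mul trmxK linearB /= tr_scalar_mx symA mulmxA.
have defAc : map_mx toC (A - c%:M) =
    P^t* *m diag_mx (\row_i (d i - c)%:C%C) *m P.
  have -> : \row_i (d i - c)%:C%C = \row_i (d i)%:C%C - const_mx c%:C%C.
    by apply/rowP => i; rewrite !mxE rmorphB.
  rewrite map_mxB map_scalar_mx defA linearB mulmxBr mulmxBl /=; congr (_ - _).
  by rewrite diag_const_mx -mulmxA mul_scalar_mx -scalemxAr PtP scalemx1.
have := nonneg_form_complex w symC psdU.
have yt : y^t* = P *m map_mx toC U^T *m w^t*.
  rewrite /y /K !trmx_mul !map_mxM; congr (_ *m _ *m _).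
    by rewrite map_trmx trmxK -map_mx_comp map_mx_id // => z; apply: conjCK.
  by rewrite [(map_mx _ U)^T]map_trmx; apply: map_mx_real_complex_conj.
set H := _ *m _ *m w^t*.
have {H}-> : H = y *m diag_mx (\row_i (d i - c)%:C%C) *m y^t*.
  by rewrite /H yt /y /K 2!map_mxM defAc !mulmxA.
apply/negP; rewrite mul_mx_diag mxE.
have termE i :
    (\matrix_(i0, j) (y i0 j * (\row_i1 (d i1 - c)%:C%C) 0 j)) 0 i * y^t* i 0
    = (d i - c)%:C%C * `|y 0 i| ^+ 2.
  by rewrite !mxE normCK mulrCA mulrA.
rewrite (eq_bigr _ (fun i _ => termE i)).
have [j yj] : exists j, y 0 j != 0 by apply/rV0Pn.
have le0 i : (d i - c)%:C%C * `|y 0 i| ^+ 2 <= 0.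
  have [iI|] := boolP (i \in I); first by rewrite yI // normr0 expr0n mulr0.
  rewrite inE -ltNge => ltd; rewrite mulr_le0_ge0 ?exprn_ge0 //.
  by rewrite lecR subr_le0 ltW.
have ltj : (d j - c)%:C%C * `|y 0 j| ^+ 2 < 0.
  have : j \notin I by apply: contraNN yj => /yI->.
  rewrite inE -ltNge => ltd; rewrite nmulr_rlt0 ?exprn_gt0 ?normr_gt0 //.
  by rewrite ltcR subr_lt0.
rewrite lt_geF // (bigD1 j) //= ltr_wnDr //; apply: sumr_le0 => i _; exact: le0.
Qed.

End RealSymmetric.

(** * Graphs with regular cells *)

Lemma sum_indicator (R : pzSemiRingType) (T : finType) (A B : {set T})
    (P : pred T) :
  B \subset A ->
  \sum_(i < #|A|) (P (enum_val i))%:R * (enum_val i \in B)%:R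
    = #|[set y in B | P y]|%:R :> R.
Proof.
move=> sBA.
rewrite -(big_enum_val (A := mem A) (fun x => (P x)%:R * (x \in B)%:R)).
rewrite (eq_bigr (fun x => if P x && (x \in B) then 1 else 0)); last first.
  by move=> x _; rewrite -natrM mulnb; case: ifP.
rewrite -big_mkcondr /= -sumr_const; apply: eq_bigl => x; rewrite inE.
by case: (boolP (x \in B)) => [/(subsetP sBA)->|]; rewrite ?andbT ?andbF.
Qed.

(** Let disjoint nonempty cells [C i] be such that each vertex of [C i] has
    [d i j] neighbours in [C j].  On vectors that are constant on the cells and
    vanish elsewhere, the form of the adjacency matrix is that of [S *m d], and
    the squared norm is that of [S], where [S] is the diagonal matrix of cell
    sizes: a Courant-Fischer subspace may be sought in dimension [m].  The
    cells need not cover [A], so this includes interlacing for the subgraph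
    that they induce. *)
Lemma eigenvalue_ge_of_regular_cells (R : rcfType) (T : finType)
    (A : {set T}) (e : rel T) m (C : 'I_m -> {set T}) (d : 'I_m -> 'I_m -> nat)
    (c : R) p (W : 'M[R]_(p.+1, m)) :
  symmetric e ->
  (forall i, C i \subset A) -> (forall i, C i != set0) ->
  (forall i j, i != j -> [disjoint C i & C j]) ->
  (forall i j x, x \in C i -> #|[set y in C j | e x y]| = d i j) ->
  row_free W ->
  nonneg_form (W *m (diag_mx (\row_i #|C i|%:R) *m
               (\matrix_(i, j) (d i j)%:R - c%:M)) *m W^T) ->
  c <= (eigenvalues (adjacency_mx R A e))`_p.
Proof.
move=> sym_e sCA C0 disjC regC freeW.
set S := diag_mx _; set D := \matrix_(i, j) _.
pose N : 'M[R]_(m, #|A|) := \matrix_(i, j) (enum_val j \in C i)%:R.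
have NNt : N *m N^T = S.
  apply/matrixP => i j; rewrite !mxE.
  under eq_bigr do rewrite !mxE.
  rewrite (sum_indicator _ (mem (C i))) //; have [<-|nij] := eqVneq i j.
    by rewrite mulr1n; congr _%:R; apply: eq_card => x; rewrite inE andbb.
  rewrite mulr0n; apply/eqP; rewrite pnatr_eq0 cards_eq0 -subset0.
  apply/subsetP => x; rewrite inE => /andP[xj xi].
  by have := disjointFr (disjC _ _ nij) xi; rewrite xj.
have NAN : N *m adjacency_mx R A e *m N^T = S *m D.
  rewrite -mulmxA.
  have AN i j : (adjacency_mx R A e *m N^T) i j
      = #|[set y in C j | e (enum_val i) y]|%:R.
    rewrite mxE; under eq_bigr do rewrite !mxE.
    by rewrite (sum_indicator _ (e (enum_val i)) (sCA j)).
  apply/matrixP => i j; rewrite mul_diag_mx !mxE.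
  under eq_bigr do rewrite AN mxE.
  rewrite -(big_enum_val (A := mem A)
             (fun x => (x \in C i)%:R * #|[set y in C j | e x y]|%:R)).
  rewrite (eq_bigr (fun x => if x \in C i then (d i j)%:R else 0)); last first.
    by move=> x _; case: ifP => xi; rewrite ?mul0r // mul1r (regC i).
  rewrite -big_mkcondr /= -mulr_natl mulr1 -sumr_const mulr_suml.
  apply: eq_big => [x|x _]; last by rewrite mul1r.
  by case: (boolP (x \in C i)) => [/(subsetP (sCA i))->|]; rewrite ?andbF.
have uS : S \in unitmx.
  rewrite unitmxE det_diag unitfE; apply/prodf_neq0 => i _.
  by rewrite mxE pnatr_eq0 cards_eq0.
have freeN : row_free N.
  by apply/row_freeP; exists (N^T *m invmx S); rewrite mulmxA NNt mulmxV.
move=> psdW; apply: (@eigenvalue_ge_of_nonneg_form _ _ _ _ _ (W *m N)).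
- by apply/matrixP => i j; rewrite !mxE sym_e.
- by rewrite /row_free mxrankMfree.
have cells : N *m (adjacency_mx R A e - c%:M) *m N^T = S *m (D - c%:M).
  rewrite mulmxBr mulmxBl NAN mul_mx_scalar -scalemxAl NNt.
  by rewrite mulmxBr mul_mx_scalar.
by rewrite trmx_mul !mulmxA -!(mulmxA W) -[S *m _]cells !mulmxA in psdW *.
Qed.

(** * The cubic *)

(** The cubic takes the values [4 n (k - 2) >= 0] at [1] and
    [- 2 k (k - 2) <= 0] at [k - 1], so it has a root [r] between them.  Its
    constant term is positive, hence the two other roots have a negative
    product: one is negative, and the second largest root is the smaller of
    [r] and the positive one. *)
Lemma quotient_cubic_second_root (R : rcfType) (k n : R) (p : {poly R}) :
  2 <= k -> 1 <= n ->
  p = 'X^3 - (k + 1)%:P * 'X^2 - (4 * n + 1)%:P * 'X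
      + (4 * k * n - 4 * n + k + 1)%:P ->
  (desc_roots p)`_1 <= k - 1 /\ root p (desc_roots p)`_1.
Proof.
move=> k2 n1 defp.
have pE x : p.[x] = x ^+ 3 - (k + 1) * x ^+ 2 - (4 * n + 1) * x
                    + (4 * k * n - 4 * n + k + 1).
  by rewrite defp !hornerE.
have [r /andP[r1 rk] /rootP pr] : exists2 r, 1 <= r <= k - 1 & root p r.
  have [||r rI pr] := @poly_ivt R (- p) 1 (k - 1); first by lra.
    by rewrite !hornerN !pE; apply/andP; split; nra.
  by exists r => //; rewrite rootN in pr.
(* The cofactor of ['X - r] is ['X^2 + b 'X + q], with roots [t] and [u]. *)
pose b := r - (k + 1); pose q := r * b - (4 * n + 1).
have q0 : q < 0.
  have : r * q = - (4 * k * n - 4 * n + k + 1).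
    by move: pr; rewrite pE /q /b => h; lra.
  nra.
pose s := Num.sqrt (b ^+ 2 - 4 * q).
have s2 : s ^+ 2 = b ^+ 2 - 4 * q by rewrite sqr_sqrtr //; nra.
have s0 : 0 <= s by apply: sqrtr_ge0.
pose t := (- b + s) / 2; pose u := (- b - s) / 2.
have u0 : u < 0.
  rewrite /u; suff : `|b| < s by rewrite ltr_norml => /andP[]; lra.
  by rewrite -(ltr_pXn2r (n := 2)) ?nnegrE // real_normK ?num_real //; lra.
have tu_sum : t + u = - b by rewrite /t /u; field.
have tu_prod : t * u = q.
  have -> : t * u = (b ^+ 2 - s ^+ 2) / 4 by rewrite /t /u; field.
  by rewrite s2; field.
have t0 : 0 < t by nra.
have splitp : p = \prod_(x <- [:: r; t; u]) ('X - x%:P).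
  rewrite !big_cons big_nil defp.
  have -> : k + 1 = r + t + u by move: tu_sum; rewrite /b; lra.
  have -> : 4 * n + 1 = - (r * t + r * u + t * u).
    by rewrite -mulrDr tu_sum tu_prod /q; ring.
  have -> : 4 * k * n - 4 * n + k + 1 = - (r * t * u).
    by rewrite -(mulrA r) tu_prod; move: pr; rewrite pE /q /b; lra.
  rewrite !(polyCD, polyCN, polyCM); ring.
have rootp x : x \in [:: r; t; u] -> root p x by rewrite splitp root_prod_XsubC.
have sort3 x y z : z <= y -> y <= x -> sort >=%R [:: x; y; z] = [:: x; y; z].
  by move=> zy yx; apply: sorted_sort => /=; [exact: ge_trans | rewrite yx zy].
rewrite [in desc_roots p]splitp desc_roots_prod.
have [le_tr|lt_rt] := leP t r.
  rewrite sort3 //=; last by lra.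
  by split; [lra | apply: rootp; rewrite !inE eqxx orbT].
have -> : sort >=%R [:: r; t; u] = sort >=%R [:: t; r; u].
  apply/perm_sortP; [exact: ge_total | exact: ge_trans | exact: ge_anti |].
  exact/permPl/(perm_catCA [:: r] [:: t] [:: u]).
rewrite sort3 /=; [|lra|lra].
by split; [lra | apply: rootp; rewrite !inE eqxx].
Qed.

(** The cubic is the characteristic polynomial of the 3 x 3 matrix with rows
    [(1, k, 2n)], [(2, k - 1, 0)] and [(2, 0, 1)]; [v] is an eigenvector for its
    root [c].  The first disjunction says that [v] is independent of the second
    basis vector. *)
Lemma quotient_kernel (R : realFieldType) (k n c : R) :
  2 <= k ->
  c ^+ 3 - (k + 1) * c ^+ 2 - (4 * n + 1) * c
    + (4 * k * n - 4 * n + k + 1) = 0 ->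
  exists v : 'I_3 -> R,
  [/\ (v 0 != 0) || (v ord_max != 0),
      (1 - c) * v 0 + k * v 1 + 2 * n * v ord_max = 0,
      2 * v 0 + (k - 1 - c) * v 1 = 0 &
      2 * v 0 + (1 - c) * v ord_max = 0].
Proof.
move=> k2 pc.
(* At [c = k - 1] the general formula below may only give a multiple of the
   second basis vector; there the cubic forces [k = 2] and [c = 1]. *)
have [eck|nck] := eqVneq c (k - 1).
  have /eqP : k * (k - 2) = 0 by move: pc; rewrite eck; lra.
  rewrite mulf_eq0 => /orP[/eqP|/eqP] k0; first by exfalso; lra.
  have {k0}ek : k = 2 by lra.
  exists (nth 0 [:: 0; 2 * n; - k]) => /=.
  rewrite eck ek; split; [|ring..].
  by rewrite oppr_eq0 pnatr_eq0 orbT.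
exists (nth 0 [:: (c - 1) * (c - k + 1); 2 * (c - 1); 2 * (c - k + 1)]) => /=.
split; [|lra|ring|ring].
rewrite orbC mulf_neq0 ?pnatr_eq0 //; apply: contraNneq nck; lra.
Qed.

(** * The dicyclic group *)

Section RegularRepresentation.

Variable n : nat.
Hypothesis n_gt0 : (0 < n)%N.

Let Z := 'Z_(2 * n).

Let m_gt1 : (1 < 2 * n)%N.
Proof. by rewrite (leq_mul2l 2 1 n). Qed.

(** The element [a^i b^s] is coded by [(i, s)]; [mul_a] and [mul_b] are the
    right multiplications by [a] and by [b] on these normal forms. *)
Definition mul_a (u : Z * bool) : Z * bool :=
  (if u.2 then u.1 - 1 else u.1 + 1, u.2).
Definition mul_b (u : Z * bool) : Z * bool :=
  (if u.2 then u.1 + n%:R else u.1, ~~ u.2).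

Lemma mul_a_inj : injective mul_a.
Proof.
by move=> [i s] [j t] [/= h st]; move: h; rewrite st; case: t {st} => /addIr->.
Qed.

Lemma mul_b_inj : injective mul_b.
Proof.
move=> [i s] [j t] [/= h /negb_inj st]; move: h.
by rewrite st; case: t {st} => [/addIr->|->].
Qed.

Let a := perm mul_a_inj.
Let b := perm mul_b_inj.

Lemma perm_a_expn (k : nat) (u : Z * bool) :
  (a ^+ k)%g u = (if u.2 then u.1 - k%:R else u.1 + k%:R, u.2).
Proof.
elim: k u => [|k IHk] [i s]; first by rewrite perm1 /= subr0 addr0 if_same.
rewrite expgSr permM IHk permE /mul_a /= -natr1.
by case: s => /=; congr (_, _); ring.
Qed.

Lemma half_turnD : (n%:R + n%:R : Z) = 0.
Proof. by rewrite -natrD addnn -mul2n char_Zp. Qed.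

(** The presentation by itself only bounds the order from above.  The
    permutations [mul_a] and [mul_b] satisfy the relations, and they generate a
    group which reaches all [4 n] points from [(0, false)], so no collapse
    occurs. *)
Lemma dicyclic_model :
  exists (gT : finGroupType) (H : {group gT}), (4 * n <= #|H|)%N /\
    (H \homg Grp (a : b : a ^+ (2 * n)%N, a ^+ n = b ^+ 2, a * b = b * a^-1))%g.
Proof.
exists {perm Z * bool}, (<[a]> <*> <[b]>)%G; split; last first.
  apply/existsP; exists (a, b); rewrite /= !xpair_eqE /= eqxx /=.
  apply/and3P; split; apply/eqP/permP => -[i s].
  - by rewrite perm_a_expn perm1 char_Zp // subr0 addr0 if_same.
  - rewrite perm_a_expn expgS expg1 permM !permE /mul_b /=.
    case: s => //=.
    by rewrite -[in LHS](addrK n%:R i) -addrA -opprD half_turnD subr0.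
  - rewrite !permM; apply: (@perm_inj _ a).
    rewrite permKV !permE /mul_a /mul_b /=.
    by case: s => /=; congr (_, _); ring.
have -> : (4 * n = #|{: Z * bool}|)%N.
  by rewrite card_prod card_bool card_ord Zp_cast // mulnAC.
pose at0 (g : {perm Z * bool}) := g (0, false).
rewrite -cardsT; apply: leq_trans (leq_imset_card at0 _).
apply/subset_leq_card/subsetP => -[i s] _; apply/imsetP.
have aG : a \in (<[a]> <*> <[b]>)%G by rewrite mem_gen // inE cycle_id.
have bG : b \in (<[a]> <*> <[b]>)%G by rewrite mem_gen // inE cycle_id orbT.
exists (a ^+ i * b ^+ s)%g; first by rewrite groupM ?groupX.
rewrite /at0 permM perm_a_expn /= add0r natr_Zp.
case: s; rewrite ?expg0 ?perm1 //.
by rewrite expg1 permE.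
Qed.

End RegularRepresentation.

Section DicyclicGroup.

Local Open Scope group_scope.

(** The relations give at most [2 #[x] <= 4 n] elements, namely the [x^i] and
    the [x^i y]; the model gives at least [4 n] since its group is an image of
    [G].  Hence equality holds throughout.  Outside [<[x]>] the square is
    [x^i y x^i y = x^i x^-i y^2 = x^n]. *)
Lemma dicyclic_structure n (gT : finGroupType) (G : {group gT}) :
  (0 < n)%N -> dicyclic n G ->
  exists2 x : gT, x \in G & [/\ #[x] = (2 * n)%N, #|G| = (4 * n)%N &
    forall g, g \in G :\: <[x]> -> g ^+ 2 = x ^+ n].
Proof.
move=> n0 hG; have := isoGrp_hom hG.
case/existsP=> -[x y] /= /eqP[defG x2n xn xy].
have Jxy : x ^ y = x^-1 by rewrite conjgE xy mulKg.
have nXY : <[y]> \subset 'N(<[x]>) by rewrite norms_cycle Jxy groupV cycle_id.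
have {}defG : <[x]> * <[y]> = G by rewrite -norm_joinEr.
have sXG : <[x]> \subset G by rewrite -defG mulG_subl.
have coset2 g : g \in G -> g \in <[x]> \/ exists i, g = x ^+ i * y.
  rewrite -defG => /mulsgP[_ _ /cycleP[i ->] /cycleP[j ->] ->].
  rewrite -(odd_double_half j) addnC expgD -mul2n expgM -xn -expgM mulgA -expgD.
  case: (odd j); first by right; exists (i + n * j./2)%N.
  by left; rewrite mulg1 mem_cycle.
have x_le : (#[x] <= 2 * n)%N by rewrite dvdn_leq ?muln_gt0 // order_dvdn x2n.
have G_le : (#|G| <= #[x] * 2)%N.
  have sG : G \subset <[x]> :|: <[x]> :* y.
    apply/subsetP => g /coset2[gX|[i ->]]; rewrite inE ?gX //.
    by rewrite mem_rcoset mulgK mem_cycle orbT.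
  apply: leq_trans (subset_leq_card sG) _.
  by rewrite (leq_trans (leq_card_setU _ _)) // card_rcoset addnn muln2.
have G_ge : (4 * n <= #|G|)%N.
  have [rT [H [leH homH]]] := dicyclic_model n0.
  by apply: leq_trans leH _; apply: leq_homg; rewrite hG.
exists x; first by rewrite -cycle_subG.
have ox : #[x] = (2 * n)%N.
  apply/eqP; rewrite eqn_leq x_le -(leq_pmul2r (isT : 0 < 2)%N) mulnAC.
  exact: leq_trans G_ge G_le.
split=> //.
  by apply/eqP; rewrite eqn_leq G_ge (leq_trans G_le) // ox mulnAC.
move=> g /setDP[/coset2[->//|[i ->] _]].
have Jxi : y * x ^+ i = x ^- i * y.
  by rewrite [RHS]conjgC conjVg conjXg Jxy expgVn invgK.
rewrite expgS expg1 -!mulgA [y * (_ * _)]mulgA Jxi.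
by rewrite -mulgA mulKVg xn expgS expg1.
Qed.

End DicyclicGroup.

(** * Three cells of the power graph *)

Section Cells.

Local Open Scope group_scope.

Variables (n : nat) (gT : finGroupType) (G : {group gT}) (x : gT).
Hypotheses (n_gt1 : (1 < n)%N) (Gx : x \in G) (ox : #[x] = (2 * n)%N).
Hypothesis (oG : #|G| = (4 * n)%N).
Hypothesis sqr_outside : forall g, g \in G :\: <[x]> -> g ^+ 2 = x ^+ n.

Let z := x ^+ n.

(** The elements of [<[x]>] of order other than 1, 2 and [2 n] are left out:
    their adjacencies depend on the divisors of [2 n]. *)
Definition cell (i : 'I_3) : {set gT} :=
  nth set0 [:: [set 1; z]; [set g | generator <[x]> g]; G :\: <[x]>] i.

Definition cell_degree (i j : 'I_3) : nat :=
  nth 0%N (nth [::] [:: [:: 1; totient (2 * n); 2 * n];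
                        [:: 2; (totient (2 * n)).-1; 0];
                        [:: 2; 0; 1]] i)%N j.

Definition cell_size (i : 'I_3) : nat :=
  nth 0%N [:: 2; totient (2 * n); 2 * n]%N i.

Let sXG : <[x]> \subset G. Proof. by rewrite cycle_subG. Qed.

Let z2 : z ^+ 2 = 1.
Proof. by rewrite -expgM mulnC -ox expg_order. Qed.

Let z_neq1 : z != 1.
Proof.
rewrite -order_dvdn ox gtnNdvd ?(ltnW n_gt1) // mul2n -addnn.
by rewrite -[X in (X < _)%N]addn0 ltn_add2l ltnW.
Qed.

Let zX : z \in <[x]>. Proof. exact: mem_cycle. Qed.

(** An element outside [<[x]>] has order 4, and its square is the involution
    [z] of [<[x]>]; so it only sees [1], [z] and its own inverse. *)
Let powers_outside g y : g \in G :\: <[x]> ->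
  (y \in <[g]>) = (y \in [:: 1; g; z; g * z]).
Proof.
move=> Og; have g2 := sqr_outside Og; apply/idP/idP; last first.
  rewrite !inE => /or4P[]/eqP->; rewrite ?group1 ?cycle_id //;
    rewrite /z -g2 ?mem_cycle //.
  by rewrite -expgS mem_cycle.
case/cycleP => j ->.
have g4 : g ^+ 4 = 1 by rewrite (expgM g 2 2) g2.
rewrite -(expg_mod j g4).
have : (j %% 4 < 4)%N by rewrite ltn_mod.
case: (j %% 4)%N => [|[|[|[|//]]]] _;
  rewrite !inE ?expg0 ?expg1 ?g2 ?eqxx ?orbT //.
by rewrite (expgS g 2) g2 -/z eqxx !orbT.
Qed.

Let gen_cycle g : generator <[x]> g -> <[g]> = <[x]>.
Proof. by move=> /eqP ->. Qed.

Let gen_neq_central g y : generator <[x]> g -> y \in [set 1; z] -> y != g.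
Proof.
move=> gen_g; apply: contraTneq => ->.
have og : #[g] = (2 * n)%N by rewrite /order gen_cycle.
apply/negP => yC; have : g ^+ 2 == 1.
  by move: yC; rewrite !inE => /orP[]/eqP->; rewrite ?expg1n ?z2.
rewrite -order_dvdn og gtnNdvd //.
by rewrite -[X in (X < _)%N]muln1 ltn_pmul2l.
Qed.

Lemma cell_sub i : cell i \subset G.
Proof.
case: i => [[|[|[|//]]] lt_i] /=; rewrite /cell /=.
- by apply/subsetP => y; rewrite !inE => /orP[]/eqP->; rewrite ?group1 ?groupX.
- apply/subsetP => y; rewrite inE => /gen_cycle eX.
  by rewrite (subsetP sXG) // -eX cycle_id.
- exact: subsetDl.
Qed.

Lemma card_cell i : #|cell i| = cell_size i.
Proof.
case: i => [[|[|[|//]]] lt_i]; rewrite /cell /cell_size /=.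
- by rewrite cards2 eq_sym z_neq1.
- by rewrite -ox totient_gen.
- by rewrite cardsD (setIidPr sXG) oG -orderE ox -mulnBl.
Qed.

Lemma cell_disjoint i j : i != j -> [disjoint cell i & cell j].
Proof.
have d01 : [disjoint [set 1; z] & [set g | generator <[x]> g]].
  rewrite -setI_eq0; apply/eqP/setP => y; rewrite in_setI in_set0.
  apply/negP => /andP[yz].
  by rewrite inE => /gen_neq_central/(_ yz); rewrite eqxx.
have d02 : [disjoint [set 1; z] & G :\: <[x]>].
  rewrite -setI_eq0; apply/eqP/setP => y; rewrite in_setI in_set0.
  apply/negP => /andP[].
  by rewrite !inE => /orP[]/eqP->; rewrite ?group1 ?zX.
have d12 : [disjoint [set g | generator <[x]> g] & G :\: <[x]>].
  rewrite -setI_eq0; apply/eqP/setP => y; rewrite in_setI in_set0.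
  apply/negP => /andP[].
  by rewrite inE => /gen_cycle <-; rewrite inE cycle_id.
by case: i j => [[|[|[|//]]] lt_i] [[|[|[|//]]] lt_j] //= _;
  rewrite /cell //= disjoint_sym.
Qed.

(** [1] and [z] are adjacent to everything in the three cells, as [z] is a power
    of every generator of [<[x]>] and the square of every outside element.
    The generators are powers of each other, an outside element is adjacent to
    its inverse alone among those outside, and no generator is adjacent to an
    outside element, by order and membership. *)
Lemma cell_regular i j g :
  g \in cell i -> #|[set y in cell j | power_graph g y]| = cell_degree i j.
Proof.
have pg_sym : symmetric (@power_graph gT).
  by move=> u v; rewrite /power_graph eq_sym orbC.
have adj01 u v : u \in [set 1; z] -> generator <[x]> v -> power_graph u v.
  move=> uC gen_v; rewrite /power_graph (gen_neq_central gen_v) //=.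
  rewrite gen_cycle //; move: uC.
  by rewrite !inE => /orP[]/eqP->; rewrite ?group1 ?zX.
have adj02 u v : u \in [set 1; z] -> v \in G :\: <[x]> -> power_graph u v.
  move=> uC Ov; rewrite /power_graph; apply/andP; split.
    apply: contraTneq uC => ->; rewrite !inE; move: Ov; rewrite inE.
    case/andP => vX _; rewrite negb_or; apply/andP.
    by split; apply: contraNneq vX => ->.
  by move: uC; rewrite (powers_outside _ Ov) !inE => /orP[]->; rewrite ?orbT.
have notadj12 u v :
    generator <[x]> u -> v \in G :\: <[x]> -> power_graph u v = false.
  move=> gen_u Ov; have /setDP[_ vX] := Ov.
  have uX : u \in <[x]> by rewrite -(gen_cycle gen_u) cycle_id.
  rewrite /power_graph (gen_cycle gen_u) (negPf vX) orbF powers_outside //.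
  have vzX : v * z \notin <[x]> by rewrite groupMr.
  apply/negP => /andP[_]; rewrite !inE => /or4P[]/eqP eq_u.
  - by have := @gen_neq_central u 1 gen_u; rewrite eq_u eqxx set21 => /(_ isT).
  - by rewrite -eq_u uX in vX.
  - by have := @gen_neq_central u z gen_u; rewrite eq_u eqxx set22 => /(_ isT).
  - by rewrite -eq_u uX in vzX.
have adj00 u v :
    u \in [set 1; z] -> v \in [set 1; z] -> power_graph u v = (u != v).
  move=> uC vC; rewrite /power_graph; have [//|nuv] := eqVneq u v.
  by move: uC vC nuv; rewrite !inE => /orP[]/eqP-> /orP[]/eqP->;
    rewrite ?eqxx // group1 ?orbT.
have adj11 u v :
    generator <[x]> u -> generator <[x]> v -> power_graph u v = (u != v).
  move=> gen_u gen_v; rewrite /power_graph !gen_cycle //.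
  by rewrite -(gen_cycle gen_u) cycle_id andbT.
have mulz_neq u : u * z != u by rewrite -[X in _ != X]mulg1 (inj_eq (mulgI u)).
have adj22 u v : u \in G :\: <[x]> -> v \in G :\: <[x]> ->
    power_graph u v = (v == u * z).
  move=> Ou Ov; have /setDP[_ uX] := Ou; have /setDP[_ vX] := Ov.
  rewrite /power_graph !powers_outside // !inE.
  have nX w : w \in <[x]> -> (u == w = false) * (v == w = false).
    move=> wX; split; apply/negbTE; first by apply: contraNneq uX => ->.
    by apply: contraNneq vX => ->.
  rewrite !(nX 1) ?group1 // !(nX z) //= [v == u]eq_sym.
  have [<-|nuv] /= := eqVneq u v; first by rewrite eq_sym (negPf (mulz_neq u)).
  have -> : (u == v * z) = (v == u * z); last by rewrite orbb.
  by apply/eqP/eqP => ->; rewrite -mulgA -[z * z]/(z ^+ 2) z2 mulg1.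
move=> gi.
have full (C : {set gT}) : {in C, forall y, power_graph g y} ->
    #|[set y in C | power_graph g y]| = #|C|.
  move=> adjC; apply: eq_card => y; rewrite inE.
  by case: (boolP (y \in C)) => // /adjC.
have others (C : {set gT}) :
    g \in C -> {in C, forall y, power_graph g y = (g != y)} ->
    #|[set y in C | power_graph g y]| = #|C|.-1.
  move=> gC adjC; rewrite [X in _ = X.-1](cardsD1 g) gC; apply: eq_card => y.
  rewrite !inE eq_sym andbC.
  by case: (boolP (y \in C)) => [/adjC->|]; rewrite ?andbF ?andbT.
have none (C : {set gT}) : {in C, forall y, power_graph g y = false} ->
    #|[set y in C | power_graph g y]| = 0%N.
  move=> adjC; apply: eq_card0 => y; rewrite inE.
  by case: (boolP (y \in C)) => // /adjC.
move: gi (card_cell j); rewrite /cell /cell_size /cell_degree.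
case: i j => [[|[|[|//]]] lt_i] [[|[|[|//]]] lt_j] /= gi oC.
- by rewrite others ?oC // => y yC; apply: adj00.
- by rewrite full // => y; rewrite inE; apply: adj01.
- by rewrite full // => y; apply: adj02.
- rewrite full // => y yC; rewrite pg_sym; apply: adj01 => //.
  by rewrite inE in gi.
- by rewrite others ?oC // => y; move: gi; rewrite !inE; apply: adj11.
- by rewrite none // => y; rewrite inE in gi; apply: notadj12.
- by rewrite full // => y yC; rewrite pg_sym; apply: adj02.
- by rewrite none // => y; rewrite inE pg_sym => gen_y; apply: notadj12.
- rewrite -(cards1 (g * z)); apply: eq_card => y; rewrite inE [RHS]inE.
  have [Oy|] := boolP (y \in _); first by rewrite adj22.
  move=> nOy; apply/esym/negbTE; apply: contraNneq nOy => ->.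
  move/setDP: gi => [gG gX].
  by rewrite inE groupMr // gX groupM // (subsetP sXG).
Qed.

Lemma cell_neq0 i : cell i != set0.
Proof.
rewrite -card_gt0 card_cell /cell_size.
case: i => [[|[|[|//]]] lt_i] //=.
  by rewrite totient_gt0 muln_gt0 (ltnW n_gt1).
by rewrite muln_gt0 (ltnW n_gt1).
Qed.

End Cells.

(** * The second largest eigenvalue *)

(* Sequences are indexed from 0, so s`_1 is the second largest entry. *)
Theorem theorem2p8 (R : rcfType) (n : nat) (hn : (2 <= n)%N)
    (gT : finGroupType) (G : {group gT}) (hG : dicyclic n G) :
  let k : R := (totient (2 * n))%:R in
  let cubic : {poly R} :=
    'X^3 - (k + 1)%:P * 'X^2 - (4 * n%:R + 1)%:P * 'X
      + (4 * k * n%:R - 4 * n%:R + k + 1)%:P in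
  let lambda := eigenvalues (adjacency_mx R G (@power_graph gT)) in
  let mu := desc_roots cubic in
  lambda`_1 >= mu`_1.
Proof.
cbv zeta; set k : R := (totient _)%:R; set cubic := (X in desc_roots X).
set c := (desc_roots cubic)`_1.
have [x Gx [ox oG sqr_out]] := dicyclic_structure (ltnW hn) hG.
have k_gt1 : (1 < totient (2 * n))%N.
  by rewrite totient_gt1 -[3%N]/(2 * 1).+1%N ltn_pmul2l.
have k2 : 2 <= k by rewrite ler_nat.
have n1 : 1 <= n%:R :> R by rewrite ler1n ltnW.
have [ck /rootP pc] := quotient_cubic_second_root k2 n1 (erefl cubic).
rewrite -/c in ck pc.
have [|v [v0 eq0 eq1 eq2]] := @quotient_kernel R k n%:R c k2.
  by rewrite -pc !hornerE.
(* The test plane is spanned by the eigenvector [v] of the quotient matrix and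
   by the indicator vector of the generators. *)
pose W : 'M[R]_(2, 3) := \matrix_(i, j) if i == 0 then v j else (j == 1)%:R.
have vW (u : 'rV[R]_2) j : (u *m W) 0 j = u 0 0 * v j + u 0 1 * (j == 1)%:R.
  rewrite mxE big_ord_recl big_ord1 !mxE (_ : lift ord0 ord0 = 1) //.
  exact: val_inj.
apply: (@eigenvalue_ge_of_regular_cells _ _ _ _ _
         (cell n G x) (cell_degree n) c 1 W).
- by move=> u w; rewrite /power_graph eq_sym orbC.
- exact: cell_sub.
- exact: cell_neq0.
- exact: cell_disjoint.
- exact: cell_regular.
- rewrite -kermx_eq0; apply/rowV0P => u /sub_kermxP/rowP uW.
  have u0 : u 0 0 = 0.
    have := uW 0; have := uW ord_max; rewrite !vW !mxE !mulr0 !addr0 => h1 h2.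
    by apply/eqP; case/orP: v0 => /mulIf-/inj_eq<-; rewrite mul0r ?h1 ?h2.
  have u1 : u 0 1 = 0 by have := uW 1; rewrite vW !mxE u0 mul0r add0r mulr1.
  apply/rowP => -[[|[|//]] lt_i]; rewrite mxE.
    by rewrite -[RHS]u0; congr (u _ _); apply: val_inj.
  by rewrite -[RHS]u1; congr (u _ _); apply: val_inj.
move=> u; set X := diag_mx _ *m _; pose y := u *m W.
have -> : u *m (W *m X *m W^T) *m u^T = y *m X *m y^T.
  by rewrite /y trmx_mul !mulmxA.
have kE : (totient (2 * n)).-1%:R = k - 1 by rewrite -subn1 natrB // ltnW.
have [y0 y1 y2] : [/\ y 0 ord0 = u 0 0 * v 0, y 0 1 = u 0 0 * v 1 + u 0 1
    & y 0 ord_max = u 0 0 * v ord_max].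
  by rewrite !vW /= !(mulr0, mulr1, addr0).
(* As [v] is in the radical of the form, only the square of the indicator
   vector, with the factor [u 0 1 ^+ 2], contributes. *)
have -> : (y *m X *m y^T) 0 0 = k * (k - 1 - c) * u 0 1 ^+ 2.
  have ord2 : lift ord0 (lift ord0 ord0) = ord_max :> 'I_3 by apply: val_inj.
  have ord1' : lift ord0 ord0 = 1 :> 'I_3 by apply: val_inj.
  clearbody y; rewrite /X mul_diag_mx mxE.
  rewrite !big_ord_recl big_ord0 addr0 ord2 ord1'.
  rewrite !mxE !big_ord_recl !big_ord0 !addr0 ord2 ord1'.
  rewrite !mxE !card_cell // /cell_size /cell_degree /= kE -/k natrM y0 y1 y2.
  rewrite !mulr0n !mulr1n !subr0.
  transitivity
    (2 * u 0 0 ^+ 2 * v 0 * ((1 - c) * v 0 + k * v 1 + 2 * n%:R * v ord_max)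
     + k * u 0 0 * (u 0 0 * v 1 + 2 * u 0 1) * (2 * v 0 + (k - 1 - c) * v 1)
     + 2 * n%:R * u 0 0 ^+ 2 * v ord_max * (2 * v 0 + (1 - c) * v ord_max)
     + k * (k - 1 - c) * u 0 1 ^+ 2).
    ring.
  by rewrite eq0 eq1 eq2 !mulr0 !add0r.
by rewrite mulr_ge0 ?sqr_ge0 // mulr_ge0 //; lra.
Qed.
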